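(* Let $E$ be a Courant algebroid over a smooth manifold $X$ whose pairing has signature $(n,n)$. Then any lagrangian subbundle $L\subseteq E$ admits a lagrangian complement, that is, there is a lagrangian subbundle $M\subseteq E$ with $L\oplus M=E$.
   Context: A Courant algebroid over a smooth manifold $X$ is a real vector bundle $E\to X$ with a nondegenerate symmetric bilinear pairing $\langle\cdot,\cdot\rangle$ on $E$, a vector bundle map $\rho:E\to TX$ (the anchor), and a bilinear bracket $[\cdot,\cdot]$ on $\Gamma(E)$ such that for all $e_1,e_2,e_3\in\Gamma(E)$: (A1) $[e_1,[e_2,e_3]]=[[e_1,e_2],e_3]+[e_2,[e_1,e_3]]$; (A2) $\rho(e_1)\langle e_2,e_3\rangle=\langle[e_1,e_2],e_3\rangle+\langle e_2,[e_1,e_3]\rangle$; (A3) $[e_1,e_2]+[e_2,e_1]=\rho^*d\langle e_1,e_2\rangle$ (with $E\cong E^*$ via the pairing). A subbundle $L\subseteq E$ is lagrangian if $L=L^\perp$ with respect to the pairing. A lagrangian complement of a lagrangian subbundle $L$ is a lagrangian subbundle $M$ with $L\oplus M=E$. *)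

(* Defs.v *)
From HB Require Import structures.
From mathcomp Require Import all_boot all_order all_algebra.
From mathcomp Require Import all_classical all_reals all_analysis.

Set Implicit Arguments.
Unset Strict Implicit.
Unset Printing Implicit Defensive.

Import Order.TTheory GRing.Theory Num.Theory.
Import numFieldNormedType.Exports.

Local Open Scope classical_set_scope.
Local Open Scope ring_scope.

(* f is C^k on the open set U: C^(k+1) means differentiable with C^k
   differential, the latter tested in every fixed direction v. *)
Fixpoint Ck_on (R : realType) (d : nat) (W : normedModType R) (k : nat)
    (U : set 'rV[R]_d) (f : 'rV[R]_d -> W) : Prop :=
  match k with
  | 0%N => {within U, continuous f}
  | k'.+1 => (forall x, U x -> differentiable f x) /\
             (forall v : 'rV[R]_d, Ck_on k' U (fun x => 'D_v f x))
  end.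

Definition Cinfty_on (R : realType) (d : nat) (W : normedModType R)
    (U : set 'rV[R]_d) (f : 'rV[R]_d -> W) : Prop :=
  forall k, Ck_on k U f.

(* A chart is a homeomorphism from an open subset of X onto an open subset of
   R^d. Both directions are total functions; the values of chart_map outside
   chart_dom, and of chart_inv outside the image of the chart, are irrelevant. *)
Record chart (R : realType) (d : nat) (X : topologicalType) := Chart {
  chart_dom : set X;
  chart_map : X -> 'rV[R]_d;
  chart_inv : 'rV[R]_d -> X;
  chart_dom_open : open chart_dom;
  chart_img_open : open (chart_map @` chart_dom);
  chart_mapK : forall x, chart_dom x -> chart_inv (chart_map x) = x;
  chart_map_cont : {within chart_dom, continuous chart_map};
  chart_inv_cont : {within chart_map @` chart_dom, continuous chart_inv}
}.

(* The atlas is not required to be maximal: any smooth atlas determines the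
   smooth structure. *)
Record smooth_manifold (R : realType) (d : nat) := SmoothManifold {
  carrier :> topologicalType;
  atlas : set (chart R d carrier);
  manifold_hausdorff : hausdorff_space carrier;
  manifold_second_countable : @second_countable carrier;
  atlas_cover : forall x : carrier, exists2 c, atlas c & chart_dom c x;
  atlas_compat : forall c1 c2, atlas c1 -> atlas c2 ->
    Cinfty_on (chart_map c1 @` (chart_dom c1 `&` chart_dom c2))
              (chart_map c2 \o chart_inv c1)
}.

Definition smooth_on (R : realType) (d : nat) (X : smooth_manifold R d)
    (W : normedModType R) (U : set X) (f : X -> W) : Prop :=
  forall c, atlas c ->
    Cinfty_on (chart_map c @` (chart_dom c `&` U)) (f \o chart_inv c).

Definition smooth_fun (R : realType) (d : nat) (X : smooth_manifold R d)
    (f : X -> R) : Prop :=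
  smooth_on setT f.

(* T_x X is the space of derivations at x of the algebra of smooth functions.
   The functional is total on X -> R, but only its values on smooth functions
   are meaningful, and only those are ever used. *)
Record tangent_vector (R : realType) (d : nat) (X : smooth_manifold R d)
    (x : X) := TangentVector {
  tv_fun :> (X -> R) -> R;
  tv_linear : forall (a : R) (f g : X -> R), smooth_fun f -> smooth_fun g ->
    tv_fun (fun y => a * f y + g y) = a * tv_fun f + tv_fun g;
  tv_leibniz : forall f g : X -> R, smooth_fun f -> smooth_fun g ->
    tv_fun (fun y => f y * g y) = f x * tv_fun g + g x * tv_fun f
}.

Definition smooth_vector_field (R : realType) (d : nat)
    (X : smooth_manifold R d) (V : forall x : X, tangent_vector x) : Prop :=
  forall f : X -> R, smooth_fun f -> smooth_fun (fun x => V x f).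

(* A local trivialization over triv_dom of a family of vector spaces, given
   fibrewise. Outside triv_dom, triv_map and triv_inv are irrelevant. *)
Record trivialization (R : realType) (X : topologicalType)
    (E : X -> lmodType R) (r : nat) := Trivialization {
  triv_dom : set X;
  triv_map : forall x, {linear E x -> 'rV[R]_r};
  triv_inv : forall x, 'rV[R]_r -> E x;
  triv_dom_open : open triv_dom;
  triv_mapK : forall x, triv_dom x -> cancel (triv_map x) (triv_inv x);
  triv_invK : forall x, triv_dom x -> cancel (triv_inv x) (triv_map x)
}.

(* The transition map x |-> t2_x \o t1_x^-1, with values in GL_r(R), is smooth
   on the overlap. *)
Definition triv_compat (R : realType) (d : nat) (X : smooth_manifold R d)
    (E : X -> lmodType R) (r : nat) (t1 t2 : trivialization E r) : Prop :=
  forall v : 'rV[R]_r,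
    smooth_on (triv_dom t1 `&` triv_dom t2)
              (fun x => triv_map t2 x (triv_inv t1 x v)).

(* A smooth real vector bundle of rank r, presented by its fibres and a smooth
   atlas of local trivializations; these determine the topology and the smooth
   structure of the total space. *)
Record vector_bundle (R : realType) (d : nat) (X : smooth_manifold R d)
    (r : nat) := VectorBundle {
  fibre :> X -> lmodType R;
  triv_atlas : set (trivialization fibre r);
  triv_cover : forall x : X, exists2 t, triv_atlas t & triv_dom t x;
  triv_atlas_compat : forall t1 t2, triv_atlas t1 -> triv_atlas t2 ->
    triv_compat t1 t2
}.

(* The smooth sections, i.e. membership in Gamma(E). *)
Definition smooth_section (R : realType) (d : nat) (X : smooth_manifold R d)
    (r : nat) (E : vector_bundle X r) (s : forall x, E x) : Prop :=
  forall t, triv_atlas t -> smooth_on (triv_dom t) (fun x => triv_map t x (s x)).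

Definition smooth_triv (R : realType) (d : nat) (X : smooth_manifold R d)
    (r : nat) (E : vector_bundle X r) (t : trivialization E r) : Prop :=
  forall t', triv_atlas t' -> triv_compat t t' /\ triv_compat t' t.

(* Every point has a smooth local trivialization of E, on its neighbourhood,
   carrying L onto the subspace R^k x 0 of R^r. *)
Definition subbundle (R : realType) (d : nat) (X : smooth_manifold R d)
    (r : nat) (E : vector_bundle X r) (k : nat) (L : forall x, set (E x)) :
    Prop :=
  (k <= r)%N /\
  forall p : X, exists t : trivialization E r,
    [/\ smooth_triv t, triv_dom t p &
        forall x, triv_dom t x ->
          L x = [set u | forall i : 'I_r, (k <= i)%N -> triv_map t x u 0 i = 0]].

(* The bracket is a total function on families of vectors, but only its values
   on smooth sections are meaningful; these it maps to smooth sections. *)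
Record courant_algebroid (R : realType) (d : nat) (X : smooth_manifold R d)
    (r : nat) (E : vector_bundle X r) := CourantAlgebroid {
  pairing : forall x, {biscalar (E x)};
  pairing_smooth : forall t, triv_atlas t -> forall v w : 'rV[R]_r,
    smooth_on (triv_dom t)
      (fun x => pairing x (triv_inv t x v) (triv_inv t x w) : R);
  pairing_sym : forall x (u v : E x), pairing x u v = pairing x v u;
  pairing_nondeg : forall x (u : E x),
    (forall v : E x, pairing x u v = 0) -> u = 0;

  anchor : forall x, E x -> tangent_vector x;
  anchor_linear : forall x (a : R) (u v : E x) (f : X -> R), smooth_fun f ->
    anchor (a *: u + v) f = a * anchor u f + anchor v f;
  anchor_smooth : forall s : forall x, E x, smooth_section s ->
    smooth_vector_field (fun x => anchor (s x));

  bracket : (forall x, E x) -> (forall x, E x) -> (forall x, E x);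
  bracket_smooth : forall e1 e2, smooth_section e1 -> smooth_section e2 ->
    smooth_section (bracket e1 e2);
  bracket_linear_l : forall (a : R) e1 e2 e3,
    smooth_section e1 -> smooth_section e2 -> smooth_section e3 ->
    forall x, bracket (fun y => a *: e1 y + e2 y) e3 x =
              a *: bracket e1 e3 x + bracket e2 e3 x;
  bracket_linear_r : forall (a : R) e1 e2 e3,
    smooth_section e1 -> smooth_section e2 -> smooth_section e3 ->
    forall x, bracket e1 (fun y => a *: e2 y + e3 y) x =
              a *: bracket e1 e2 x + bracket e1 e3 x;

  bracket_jacobi : forall e1 e2 e3,
    smooth_section e1 -> smooth_section e2 -> smooth_section e3 ->
    forall x, bracket e1 (bracket e2 e3) x =
              bracket (bracket e1 e2) e3 x + bracket e2 (bracket e1 e3) x;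
  bracket_pairing : forall e1 e2 e3,
    smooth_section e1 -> smooth_section e2 -> smooth_section e3 ->
    forall x, anchor (e1 x) (fun y => pairing y (e2 y) (e3 y)) =
              pairing x (bracket e1 e2 x) (e3 x) +
              pairing x (e2 x) (bracket e1 e3 x);
  (* [e1, e2] + [e2, e1] = rho^* d <e1, e2>: under E ~ E^*, the section
     rho^* d f is the one whose pairing with u is df(rho u) = (rho u) f. *)
  bracket_symmetric_part : forall e1 e2,
    smooth_section e1 -> smooth_section e2 ->
    forall x (u : E x),
      pairing x (bracket e1 e2 x + bracket e2 e1 x) u =
      anchor u (fun y => pairing y (e1 y) (e2 y))
}.

Definition form_has_signature (R : realType) (V : lmodType R)
    (b : V -> V -> R) (p q : nat) : Prop :=
  exists2 phi : {linear V -> 'rV[R]_(p + q)}, bijective phi &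
    forall u v, b u v =
      \sum_(i < p) phi u 0 (lshift q i) * phi v 0 (lshift q i) -
      \sum_(j < q) phi u 0 (rshift p j) * phi v 0 (rshift p j).

Section Lagrangian.
Variables (R : realType) (d : nat) (X : smooth_manifold R d) (r : nat).
Variables (E : vector_bundle X r) (C : courant_algebroid E).

Definition pairing_has_signature (p q : nat) : Prop :=
  forall x : X, form_has_signature (fun u v : E x => pairing C x u v) p q.

Definition orthogonal_of (x : X) (V : set (E x)) : set (E x) :=
  [set u | forall v, V v -> pairing C x u v = 0].

Definition lagrangian_subbundle (L : forall x, set (E x)) : Prop :=
  (exists k, subbundle k L) /\ forall x, L x = orthogonal_of (L x).

End Lagrangian.

Definition direct_sum_decomposition (R : realType) (d : nat)
    (X : smooth_manifold R d) (r : nat) (E : vector_bundle X r)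
    (L M : forall x, set (E x)) : Prop :=
  forall x, (L x `&` M x = [set 0]) /\
    forall u : E x, exists l m, [/\ L x l, M x m & u = l + m].

(* Main.v *)
(* A lagrangian complement of L amounts to a projection p of E onto L with
   <p u, v> + <u, p v> = <u, v>, the complement being ker p. These conditions are
   affine in p, so local solutions can be glued by a smooth partition of unity.
   Locally, L has some projection p0, and with its adjoint p0^* with respect to
   the pairing, p = (1 + p0 - p0^* ) / 2 is a solution: p0^* vanishes on L because
   L is isotropic, and p takes its values in L^perp = L. A subordinate partition
   of unity is obtained from bump functions f_0, f_1, ... that are equal to 1 on
   the members of a countable open cover: the weights (1 - f_0) ... (1 - f_(i-1)) f_i
   are locally finite, because all later weights vanish where f_i = 1. *)

Require Import Defs.
From HB Require Import structures.
From mathcomp Require Import all_boot all_order all_algebra.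
From mathcomp Require Import all_classical all_reals all_analysis.
From mathcomp Require Import ring lra zify.

Set Implicit Arguments.
Unset Strict Implicit.
Unset Printing Implicit Defensive.

Import Order.TTheory GRing.Theory Num.Theory.
Import numFieldNormedType.Exports.

Local Open Scope classical_set_scope.
Local Open Scope ring_scope.

(** * Functions of class C^k on open subsets of R^d *)

(** Differentiability depends only on the germ: the first-order expansion of [f] at [x] is also one
    of [g], and by uniqueness of the differential ['d f x] is the differential of [g]. *)
Lemma near_eq_differentiable (R : realType) (V W : normedModType R)
    (f g : V -> W) (x : V) :
  (\forall y \near x, f y = g y) -> differentiable f x -> differentiable g x.
Proof.
move=> fg /diff_locallyP[df fE].
have fg0 : \forall h \near 0, f (h + x) = g (h + x).
  by rewrite (near_shift x) sub0r; apply: filterS fg => y /=; rewrite subrK.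
have gE : g \o shift x = cst (g x) + 'd f x +o_ 0 id.
  move/eqaddoP: fE => fE; apply/eqaddoP => e e0.
  near=> h.
  suff -> : ((g \o shift x) - (cst (g x) + 'd f x)) h =
    ((f \o shift x) - (cst (f x) + 'd f x)) h.
    by near: h; exact: fE.
  rewrite !fctE /=.
  have -> : g (h + x) = f (h + x).
    by apply/esym; near: h.
  by rewrite (nbhs_singleton fg).
have dE := diff_unique df gE.
by apply/diff_locallyP; rewrite dE.
Unshelve. all: by end_near. Qed.

Section Ck_on_closure.
Context {R : realType} {d : nat}.
Implicit Types U V : set 'rV[R]_d.

Lemma Ck_on0P (W : normedModType R) U (f : 'rV[R]_d -> W) : open U ->
  Ck_on 0 U f <-> forall x, U x -> {for x, continuous f}.
Proof.
move=> oU; rewrite /= continuous_open_subspace//; split.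
  by move=> cf x Ux; apply: cf; rewrite inE.
by move=> cf x; rewrite inE => /cf.
Qed.

(** Derivatives at a point depend only on the germ there, so the induction on [k] may replace [f] by
    a local model [g]. The closure properties below rest on this, since the usual derivative
    formulas hold on [U] only. *)
Lemma Ck_on_local (W : normedModType R) k U (f : 'rV[R]_d -> W) : open U ->
  (forall x, U x -> exists V g,
    [/\ open V, V x, Ck_on k V g & forall y, V y -> f y = g y]) ->
  Ck_on k U f.
Proof.
elim: k f => [|k IH] f oU loc.
  apply/Ck_on0P => // x /loc [V [g [oV Vx /(Ck_on0P g oV) Cg fg]]].
  have fgV : \forall y \near x, g y = f y.
    by apply: (filterS _ (open_nbhs_nbhs (conj oV Vx))) => y /fg.
  suff : f @ x --> g x by rewrite -(fg _ Vx).
  exact: cvg_trans (near_eq_cvg fgV) (Cg _ Vx).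
split=> [x /loc[V [g [oV Vx [dg _] fg]]]|v].
  apply: near_eq_differentiable (dg x Vx).
  by apply: (filterS _ (open_nbhs_nbhs (conj oV Vx))) => y /fg.
apply: IH => // x /loc[V [g [oV Vx [_ Dg] fg]]].
exists V, (fun x => 'D_v g x); split => //; first exact: Dg.
move=> y Vy.
apply: near_eq_derive.
by apply: (filterS _ (open_nbhs_nbhs (conj oV Vy))) => z /fg.
Qed.

Lemma Ck_on_eq (W : normedModType R) k U (f g : 'rV[R]_d -> W) : open U ->
  (forall y, U y -> f y = g y) -> Ck_on k U g -> Ck_on k U f.
Proof. by move=> oU fg Cg; apply: Ck_on_local => // x Ux; exists U, g. Qed.

Lemma Ck_onS (W : normedModType R) k U V (f : 'rV[R]_d -> W) : open U -> open V ->
  U `<=` V -> Ck_on k V f -> Ck_on k U f.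
Proof.
by move=> oU oV UV CV; apply: Ck_on_local => // x /UV Vx; exists V, f.
Qed.

Lemma Ck_on_pred (W : normedModType R) k U (f : 'rV[R]_d -> W) : open U ->
  Ck_on k.+1 U f -> Ck_on k U f.
Proof.
elim: k f => [|k IH] f oU [df Df].
  by apply/Ck_on0P => // x Ux; exact/differentiable_continuous/df.
by split=> // v; apply: IH.
Qed.

Lemma Ck_on_cst (W : normedModType R) k U (a : W) : open U ->
  Ck_on k U (fun=> a).
Proof.
elim: k a => [|k IH] a oU; first by apply/Ck_on0P => // x Ux; exact: cst_continuous.
split=> [x Ux|v]; first exact: differentiable_cst.
by apply: (Ck_on_eq oU _ (IH 0 oU)) => y _; rewrite derive_cst.
Qed.

Lemma Ck_onD (W : normedModType R) k U (f g : 'rV[R]_d -> W) : open U ->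
  Ck_on k U f -> Ck_on k U g -> Ck_on k U (fun x => f x + g x).
Proof.
elim: k f g => [|k IH] f g oU.
  move=> /Ck_on0P cf /Ck_on0P cg; apply/Ck_on0P => // x Ux.
  by apply: continuousD; [exact: cf|exact: cg].
move=> [df Df] [dg Dg]; split=> [x Ux|v].
  by apply: differentiableD; [exact: df|exact: dg].
apply: (Ck_on_eq oU _ (IH _ _ oU (Df v) (Dg v))) => y Uy.
by rewrite deriveD //; apply: diff_derivable; [exact: df|exact: dg].
Qed.

Lemma Ck_onM k U (f g : 'rV[R]_d -> R) : open U ->
  Ck_on k U f -> Ck_on k U g -> Ck_on k U (fun x => f x * g x).
Proof.
elim: k f g => [|k IH] f g oU.
  move=> /Ck_on0P cf /Ck_on0P cg; apply/Ck_on0P => // x Ux.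
  by apply: continuousM; [exact: cf|exact: cg].
move=> Cf Cg; have [df Df] := Cf; have [dg Dg] := Cg; split=> [x Ux|v].
  by apply: differentiableM; [exact: df|exact: dg].
have Cf' := Ck_on_pred oU Cf; have Cg' := Ck_on_pred oU Cg.
apply: Ck_on_eq (Ck_onD oU (IH _ _ oU Cf' (Dg v)) (IH _ _ oU Cg' (Df v))) => //.
move=> y Uy; rewrite deriveM //; apply: diff_derivable; [exact: df|exact: dg].
Qed.

Lemma Ck_on_sum (W : normedModType R) (I : Type) (s : seq I) k U
    (f : I -> 'rV[R]_d -> W) : open U ->
  (forall i, Ck_on k U (f i)) -> Ck_on k U (fun x => \sum_(i <- s) f i x).
Proof.
move=> oU Cf; elim: s => [|i s IH].
  by apply: (Ck_on_eq oU _ (Ck_on_cst k 0 oU)) => y _; rewrite big_nil.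
by apply: (Ck_on_eq oU _ (Ck_onD oU (Cf i) IH)) => y _; rewrite big_cons.
Qed.

Lemma Ck_on_coord m k U (f : 'rV[R]_d -> 'rV[R]_m) (j : 'I_m) : open U ->
  Ck_on k U f -> Ck_on k U (fun x => f x 0 j).
Proof.
elim: k f => [|k IH] f oU.
  move=> /Ck_on0P cf; apply/Ck_on0P => // x Ux.
  by apply: (@continuous_comp _ _ _ f (fun N : 'rV[R]_m => N 0 j));
    [exact: cf|exact: coord_continuous].
move=> [df Df]; split=> [x Ux|v].
  by apply: (@differentiable_comp _ _ _ _ f (fun N : 'rV[R]_m => N 0 j));
    [exact: df|exact: differentiable_coord].
apply: (Ck_on_eq oU _ (IH _ oU (Df v))) => y Uy.
by rewrite derive_mx ?mxE//; apply: diff_derivable; exact: df.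
Qed.

Lemma Ck_on_scalel (W : normedModType R) k U (f : 'rV[R]_d -> R) (a : W) : open U ->
  Ck_on k U f -> Ck_on k U (fun x => f x *: a).
Proof.
elim: k f => [|k IH] f oU.
  move=> /Ck_on0P cf; apply/Ck_on0P => // x Ux.
  by apply: (@continuous_comp _ _ _ f (fun r : R => r *: a));
    [exact: cf|exact: scalel_continuous].
move=> [df Df]; split=> [x Ux|v].
  by apply: differentiableZl; exact: df.
apply: (Ck_on_eq oU _ (IH _ oU (Df v))) => y Uy.
have dfy := df y Uy.
by rewrite !deriveE//; [rewrite diffZl|exact: differentiableZl].
Qed.

Lemma Ck_on_rowP m k U (f : 'rV[R]_d -> 'rV[R]_m) : open U ->
  Ck_on k U f <-> forall j, Ck_on k U (fun x => f x 0 j).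
Proof.
move=> oU; split=> [Cf j|Cf]; first exact: Ck_on_coord.
apply: (Ck_on_eq oU _ (Ck_on_sum (index_enum 'I_m) oU
  (fun j => Ck_on_scalel (delta_mx 0 j) oU (Cf j)))).
by move=> y _; rewrite [LHS]row_sum_delta.
Qed.

(** The chain rule brings in the derivative of [h], so the induction on [k] runs over a whole class
    [S] closed under derivation at the points of [D]. Below, [S] consists of the polynomials in 1/t
    or of the flat functions. *)
Lemma Ck_on_comp_family (S : set (R -> R)) (D : set R) k U
    (f : 'rV[R]_d -> R) (h : R -> R) :
  (forall h, S h -> exists2 h', S h' &
    forall t, D t -> is_derive t (1 : R) h (h' t)) ->
  open U -> (forall x, U x -> D (f x)) -> Ck_on k U f -> S h ->
  Ck_on k U (h \o f).
Proof.
move=> SD oU UD; elim: k h => [|k IH] h.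
  move=> /Ck_on0P cf /SD[h' _ hh']; apply/Ck_on0P => // x Ux.
  apply: continuous_comp; first exact: cf.
  have [dh _] := hh' _ (UD x Ux).
  by apply: differentiable_continuous; apply/derivable1_diffP.
move=> Cf Sh; have [df Df] := Cf; have [h' Sh' hh'] := SD h Sh.
have dh x : U x -> differentiable h (f x).
  by move=> Ux; have [? _] := hh' _ (UD x Ux); apply/derivable1_diffP.
split=> [x Ux|v].
  by apply: differentiable_comp; [exact: df|exact: dh].
have Cf' := Ck_on_pred oU Cf.
apply: (Ck_on_eq oU _ (Ck_onM oU (IH h' Cf' Sh') (Df v))) => y Uy.
have dfy := df y Uy; have dhy := dh y Uy.
rewrite deriveE; last exact: differentiable_comp.
rewrite diff_comp//= -(deriveE _ dfy).
(* By linearity, the differential of [h] applied to a number is that number times its value at 1. *)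
rewrite -[X in 'd h _ X]mulr1 [LHS]linearZ /= -(deriveE _ dhy).
have [_ ->] := hh' _ (UD y Uy).
by rewrite mulrC.
Qed.

End Ck_on_closure.

(* The partial derivatives of h, composed with f, occur in the derivative of the
   composite, so the induction is on k for all h and f simultaneously. *)
Lemma Ck_on_comp (R : realType) d m k (U : set 'rV[R]_d) (V : set 'rV[R]_m)
    (f : 'rV[R]_d -> 'rV[R]_m) (h : 'rV[R]_m -> R) :
  open U -> open V -> (forall x, U x -> V (f x)) ->
  Ck_on k U f -> Ck_on k V h -> Ck_on k U (h \o f).
Proof.
move=> oU oV UV; elim: k h f UV => [|k IH] h f UV.
  move=> /Ck_on0P cf /Ck_on0P ch; apply/Ck_on0P => // x Ux.
  by apply: continuous_comp; [exact: cf|apply: ch => //; exact: UV].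
move=> Cf [dh Dh]; have [df Df] := Cf; split=> [x Ux|v].
  by apply: differentiable_comp; [exact: df|exact/dh/UV].
have Cf' := Ck_on_pred oU Cf.
pose F j x := 'D_v f x 0 j * ('D_(delta_mx 0 j) h \o f) x.
have CF j : Ck_on k U (F j).
  exact: Ck_onM oU (Ck_on_coord j oU (Df v)) (IH _ _ UV Cf' (Dh _)).
apply: (Ck_on_eq oU _ (Ck_on_sum (index_enum 'I_m) oU CF)) => y Uy.
have dfy := df y Uy; have dhy := dh _ (UV y Uy).
rewrite deriveE; last exact: differentiable_comp.
rewrite diff_comp//= -(deriveE _ dfy) [X in 'd h _ X]row_sum_delta linear_sum.
by apply: eq_bigr => j _; rewrite /F /= linearZ /= -deriveE.
Qed.

(** * Smooth functions on a manifold *)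

Lemma is_derive_invr (R : realType) (t : R) : t != 0 ->
  is_derive t (1 : R) GRing.inv (- t ^- 2).
Proof.
move=> t0; apply: is_derive_eq (is_deriveV t0 (is_derive_id t (1 : R))) _.
exact: mulr1.
Qed.

Section Smooth_on_closure.
Context {R : realType} {d : nat} {X : smooth_manifold R d}.
Implicit Types U V : set X.

(** Within the open image of the chart, the set in question is the preimage of [U] under the
    continuous map [chart_inv c]. *)
Lemma chart_image_open (c : chart R d X) U : open U ->
  open (chart_map c @` (chart_dom c `&` U)).
Proof.
move=> oU; rewrite openE => _ [y [cy Uy] <-].
have oI := @chart_img_open _ _ _ c.
have Iy : (chart_map c @` chart_dom c) (chart_map c y) by exists y.
have ci : {for chart_map c y, continuous (chart_inv c)}.
  have := @chart_inv_cont _ _ _ c.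
  by rewrite continuous_open_subspace// => /(_ _ (mem_set Iy)).
have nU : nbhs (chart_inv c (chart_map c y)) U.
  by rewrite chart_mapK//; exact: open_nbhs_nbhs.
apply: filterS2 (open_nbhs_nbhs (conj oI Iy)) (ci _ nU).
move=> _ [w cw <-]; rewrite /= chart_mapK// => Uw; exists w => //.
Qed.

Lemma smooth_on_local (W : normedModType R) U (f : X -> W) : open U ->
  (forall x, U x -> exists V g,
    [/\ open V, V x, smooth_on V g & forall y, V y -> f y = g y]) ->
  smooth_on U f.
Proof.
move=> oU loc c Ac k; apply: Ck_on_local; first exact: chart_image_open.
move=> _ [y [cy Uy] <-]; have [V [g [oV Vy sg fg]]] := loc y Uy.
exists (chart_map c @` (chart_dom c `&` V)), (g \o chart_inv c); split.
- exact: chart_image_open.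
- by exists y.
- exact: sg.
- by move=> _ [w [cw Vw] <-] /=; rewrite chart_mapK// fg.
Qed.

Lemma smooth_on_eq (W : normedModType R) U (f g : X -> W) : open U ->
  (forall y, U y -> f y = g y) -> smooth_on U g -> smooth_on U f.
Proof. by move=> oU fg sg; apply: smooth_on_local => // x Ux; exists U, g. Qed.

Lemma smooth_onS (W : normedModType R) U V (f : X -> W) : open U -> open V ->
  U `<=` V -> smooth_on V f -> smooth_on U f.
Proof.
by move=> oU oV UV sV; apply: smooth_on_local => // x /UV Vx; exists V, f.
Qed.

Lemma smooth_on_cst (W : normedModType R) U (a : W) : open U ->
  smooth_on U (fun=> a).
Proof. by move=> oU c Ac k; apply: Ck_on_cst; exact: chart_image_open. Qed.

Lemma smooth_onD (W : normedModType R) U (f g : X -> W) : open U ->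
  smooth_on U f -> smooth_on U g -> smooth_on U (fun x => f x + g x).
Proof.
move=> oU sf sg c Ac k.
apply: (@Ck_onD _ _ _ _ _ (f \o chart_inv c) (g \o chart_inv c));
  [exact: chart_image_open|exact: sf|exact: sg].
Qed.

Lemma smooth_onM U (f g : X -> R) : open U ->
  smooth_on U f -> smooth_on U g -> smooth_on U (fun x => f x * g x).
Proof.
move=> oU sf sg c Ac k.
apply: (@Ck_onM _ _ _ _ (f \o chart_inv c) (g \o chart_inv c));
  [exact: chart_image_open|exact: sf|exact: sg].
Qed.

Lemma smooth_on_sum (W : normedModType R) (I : Type) (s : seq I) U
    (f : I -> X -> W) : open U ->
  (forall i, smooth_on U (f i)) -> smooth_on U (fun x => \sum_(i <- s) f i x).
Proof.
move=> oU sf c Ac k.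
apply: (@Ck_on_sum _ _ _ _ _ _ _ (fun i => f i \o chart_inv c)) => [|i];
  [exact: chart_image_open|exact: sf].
Qed.

Lemma smooth_on_prod (I : Type) (s : seq I) U (f : I -> X -> R) : open U ->
  (forall i, smooth_on U (f i)) -> smooth_on U (fun x => \prod_(i <- s) f i x).
Proof.
move=> oU sf; elim: s => [|i s IH].
  apply: (smooth_on_eq oU _ (smooth_on_cst (1 : R) oU)) => y _.
  by rewrite big_nil.
by apply: (smooth_on_eq oU _ (smooth_onM oU (sf i) IH)) => y _; rewrite big_cons.
Qed.

Lemma smooth_on_rowP m U (f : X -> 'rV[R]_m) : open U ->
  smooth_on U f <-> forall j, smooth_on U (fun x => f x 0 j).
Proof.
move=> oU; split=> sf; first by move=> j c Ac k; apply: Ck_on_coord (sf c Ac k);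
  exact: chart_image_open.
move=> c Ac k; apply/Ck_on_rowP; first exact: chart_image_open.
by move=> j; exact: sf.
Qed.

Lemma smooth_on_comp_family (S : set (R -> R)) (D : set R) U
    (f : X -> R) (h : R -> R) :
  (forall h, S h -> exists2 h', S h' &
    forall t, D t -> is_derive t (1 : R) h (h' t)) ->
  open U -> (forall x, U x -> D (f x)) -> smooth_on U f -> S h ->
  smooth_on U (h \o f).
Proof.
move=> SD oU UD sf Sh c Ac k.
apply: (Ck_on_comp_family SD _ _ (sf c Ac k) Sh); first exact: chart_image_open.
by move=> _ [y [cy Uy] <-] /=; rewrite chart_mapK//; exact: UD.
Qed.

(** Read in another chart, the function is [h] after a transition map, which is smooth by
    [atlas_compat]. *)
Lemma smooth_on_chart_comp (c : chart R d X) U (V : set 'rV[R]_d)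
    (h : 'rV[R]_d -> R) : atlas c -> open U -> open V ->
  (forall x, U x -> chart_dom c x /\ V (chart_map c x)) ->
  Cinfty_on V h -> smooth_on U (h \o chart_map c).
Proof.
move=> Ac oU oV UV sh c' Ac' k.
pose f := chart_map c \o chart_inv c'.
apply: (@Ck_on_comp _ _ _ _ _ V f h) => //; first exact: chart_image_open.
- by move=> _ [y [cy /UV[_ Vy]] <-]; rewrite /f /= chart_mapK.
- apply: (Ck_onS _ _ _ (atlas_compat Ac' Ac k)).
  + exact: chart_image_open.
  + exact/chart_image_open/chart_dom_open.
  + by move=> _ [y [cy /UV[cy' _]] <-]; exists y.
Qed.

Lemma smooth_on_inv U (f : X -> R) : open U -> (forall x, U x -> f x != 0) ->
  smooth_on U f -> smooth_on U (fun x => (f x)^-1).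
Proof.
move=> oU f0 sf.
(* Polynomials in 1/t are closed under derivation away from 0: the derivative of p(1/t) is
   -p'(1/t)/t^2. *)
pose S : set (R -> R) := [set h | exists p : {poly R}, h = fun t => p.[t^-1]].
apply: (@smooth_on_comp_family S [set t | t != 0] U f GRing.inv) => //; last first.
  by exists 'X; apply/funext => t; rewrite hornerX.
move=> _ [p ->]; exists (fun t => (- (p^`() * 'X^2)).[t^-1]).
  by exists (- (p^`() * 'X^2)).
move=> t /= t0; apply: is_derive_eq (is_derive1_comp (is_derive_poly p t^-1)
  (is_derive_invr t0)) _.
by rewrite hornerN hornerM hornerXn mulrN exprVn.
Qed.

End Smooth_on_closure.

(** * Bump functions *)

Section Bump_function.
Context {R : realType}.

(* p(1/t) exp(-1/t) for t > 0, extended by 0: a family closed under derivation. *)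
Definition flat_fun (p : {poly R}) (t : R) : R :=
  if 0 < t then p.[t^-1] * expR (- t^-1) else 0.

Lemma horner_le_monomial (p : {poly R}) :
  exists2 C : R, 0 <= C & forall s, 1 <= s -> `|p.[s]| <= C * s ^+ size p.
Proof.
exists (\sum_(i < size p) `|p`_i|); first exact: sumr_ge0.
move=> s s1; rewrite horner_coef (le_trans (ler_norm_sum _ _ _))// mulr_suml.
apply: ler_sum => i _; rewrite normrM ler_wpM2l//.
rewrite ger0_norm; last by rewrite exprn_ge0// (le_trans ler01).
by apply: ler_weXn2l => //; exact: ltnW.
Qed.

(** Put s = 1/t and n = [size p]. Then |p(s)| <= C s^n, while exp(s) >= s^(n+1)/(n+1)!, so |p(s)|
    exp(-s) is at most C (n+1)! t. *)
Lemma flat_fun_bound (p : {poly R}) :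
  exists2 C : R, 0 <= C & forall t, 0 < t -> t <= 1 -> `|flat_fun p t| <= C * t.
Proof.
have [C C0 pC] := horner_le_monomial p.
pose n := size p; exists (C * n.+1`!%:R); first by rewrite mulr_ge0.
move=> t t0 t1; rewrite /flat_fun t0 normrM.
have s0 : 0 < t^-1 by rewrite invr_gt0.
have s1 : 1 <= t^-1 by rewrite invf_ge1.
rewrite [`|expR _|]ger0_norm ?expR_ge0// expRN.
have eE : t^-1 ^+ n.+1 / n.+1`!%:R <= expR t^-1.
  by apply: le_trans (expR_ge1Dxn n (ltW s0)); rewrite lerDr.
have f0 : 0 < n.+1`!%:R :> R by rewrite ltr0n fact_gt0.
have q0 : 0 < t^-1 ^+ n.+1 / n.+1`!%:R :> R by rewrite divr_gt0// exprn_gt0.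
have eE' : (expR t^-1)^-1 <= n.+1`!%:R * t ^+ n.+1.
  rewrite -[leRHS]invrK lef_pV2 ?posrE ?expR_gt0 ?invr_gt0 ?mulr_gt0 ?exprn_gt0//.
  by rewrite invfM -exprVn mulrC.
apply: le_trans (ler_pM _ _ (pC _ s1) eE') _; rewrite ?invr_ge0 ?expR_ge0//.
have -> : C * t^-1 ^+ size p * (n.+1`!%:R * t ^+ n.+1) =
  C * n.+1`!%:R * t * (t^-1 * t) ^+ n by rewrite exprMn exprS; ring.
by rewrite mulVf ?gt_eqF// expr1n mulr1.
Qed.

Lemma flat_fun_norm_bound (p : {poly R}) :
  exists2 C : R, 0 <= C & forall t, `|t| <= 1 -> `|flat_fun p t| <= C * `|t|.
Proof.
have [C C0 pC] := flat_fun_bound p; exists C => // t.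
case: (ltP 0 t) => [t0|t0]; first by rewrite [`|t|]gtr0_norm//; exact: pC.
by rewrite /flat_fun ltNge t0 /= normr0 mulr_ge0.
Qed.

(** For t > 0 this is the product rule. At 0 the difference quotient of [flat_fun p] is
    [flat_fun ('X * p)], which tends to 0 by the linear bound. *)
Lemma is_derive_flat_fun (p : {poly R}) (t : R) :
  is_derive t (1 : R) (flat_fun p) (flat_fun ('X^2 * (p - p^`())) t).
Proof.
have [t0|t0|->] := ltgtP t 0.
- rewrite {2}/flat_fun ltNge ltW//=.
  apply: (@near_eq_is_derive _ _ _ (cst 0)) => //; near=> s.
  rewrite /flat_fun ltNge ltW//=; near: s; exact: lt_nbhsl.
- rewrite {2}/flat_fun t0.
  apply: (@near_eq_is_derive _ _ _ (fun s : R => p.[s^-1] * expR (- s^-1))).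
    near=> s; rewrite /flat_fun ifT//; near: s; exact: lt_nbhsr.
  have tn0 : t != 0 by rewrite gt_eqF.
  have dp := is_derive1_comp (is_derive_poly p t^-1) (is_derive_invr tn0).
  have dN : is_derive t (1 : R) (fun s : R => - s^-1) (- - t ^- 2).
    exact: is_deriveN (is_derive_invr tn0).
  have de := @is_derive1_comp _ expR _ t _ _ (is_derive_expR _) dN.
  apply: is_derive_eq (is_deriveM dp de) _.
  rewrite /= !hornerE /= -!exprVn /GRing.scale /=; ring.
- rewrite {2}/flat_fun ltxx.
  have [C C0 pC] := flat_fun_norm_bound ('X * p).
  have f0 : flat_fun p 0 = 0 by rewrite /flat_fun ltxx.
  have lim0 : h^-1 *: ((flat_fun p \o shift 0) (h *: (1 : R)) - flat_fun p 0)
      @[h --> 0^'] --> (0 : R).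
    apply/cvgr0Pnorm_le => e e0; near=> h.
    have h0 : h != 0 by near: h; exact: nbhs_dnbhs_neq.
    rewrite /= f0 subr0 addr0 [h *: 1]mulr1.
    have -> : h^-1 *: flat_fun p h = flat_fun ('X * p) h.
      rewrite /flat_fun; case: ifP => _; last by rewrite scaler0.
      by rewrite hornerM hornerX /GRing.scale /=; ring.
    apply: le_trans (pC _ _) _.
      by near: h; apply: dnbhs0_le.
    (* [C + 1] replaces [C], which may be 0, so that [e] can be divided by it. *)
    rewrite (@le_trans _ _ ((C + 1) * `|h|)) ?ler_wpM2r ?lerDl//.
    rewrite mulrC -ler_pdivlMr ?ltr_wpDl//.
    by near: h; apply: dnbhs0_le; rewrite divr_gt0 ?ltr_wpDl.
  apply: DeriveDef; first by apply/cvg_ex; exists 0.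
  exact/cvg_lim.
Unshelve. all: by end_near. Qed.
End Bump_function.

Lemma Ck_on_flat_fun (R : realType) (d k : nat) (U : set 'rV[R]_d)
    (f : 'rV[R]_d -> R) p :
  open U -> Ck_on k U f -> Ck_on k U (fun x => flat_fun p (f x)).
Proof.
move=> oU Cf.
apply: (@Ck_on_comp_family _ _ (range flat_fun) setT _ _ f (flat_fun p)) => //.
  move=> _ [q _ <-]; exists (flat_fun ('X^2 * (q - q^`()))).
    by exists ('X^2 * (q - q^`())).
  by move=> t _; exact: is_derive_flat_fun.
Qed.

Lemma Ck_on_id (R : realType) (d k : nat) (U : set 'rV[R]_d) :
  open U -> Ck_on k U (@id 'rV[R]_d).
Proof.
case: k => [|k] oU; first by apply/Ck_on0P => // x _; exact: cvg_id.
split=> [x _|v]; first exact: ex_diff.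
by apply: (Ck_on_eq oU _ (Ck_on_cst k v oU)) => y _; rewrite derive_id.
Qed.

(** Two flat cutoffs in a row produce a plateau. [u] is positive exactly where [q z < e ^+ 2]; [l]
    is -1 at [a], and 1 where [u] vanishes; [h] is 1 where [l] is at most 0, hence near [a], and 0
    where [l] is 1. *)
Lemma bump_rV (R : realType) (d : nat) (a : 'rV[R]_d) (e : R) : 0 < e ->
  exists h : 'rV[R]_d -> R, [/\ Cinfty_on setT h,
    exists V, [/\ open V, V a & forall z, V z -> h z = 1] &
    forall z, h z != 0 -> `|a - z| <= e].
Proof.
move=> e0.
(* The squared Euclidean distance to [a]: it is polynomial, and it bounds the square of the norm of
   [a - z], which is the maximum norm. *)
pose q (z : 'rV[R]_d) := \sum_(i < d) (a 0 i - z 0 i) * (a 0 i - z 0 i).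
have qa : q a = 0 by rewrite /q big1// => i _; rewrite subrr mulr0.
have flat_gt0 (t : R) : 0 < t -> 0 < flat_fun 1 t.
  by move=> t0; rewrite /flat_fun t0 hornerE mul1r expR_gt0.
have flat_le0 p (t : R) : t <= 0 -> flat_fun p t = 0.
  by move=> t0; rewrite /flat_fun ltNge t0.
pose c : R := flat_fun 1 (e ^+ 2).
have c0 : 0 < c by rewrite flat_gt0// exprn_gt0.
pose u z := flat_fun 1 (e ^+ 2 - q z).
pose l z := 1 - 2 / c * u z.
have Cl : Cinfty_on setT l.
  have oT : open [set: 'rV[R]_d] := openT.
  move=> k; have Ccoord i := Ck_on_coord i oT (Ck_on_id k oT).
  have CN (f : 'rV[R]_d -> R) : Ck_on k setT f -> Ck_on k setT (fun z => - f z).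
    move=> Cf; apply: (Ck_on_eq oT _ (Ck_onM oT (Ck_on_cst k (-1 : R) oT) Cf)).
    by move=> z _; rewrite mulN1r.
  have CB i : Ck_on k setT (fun z : 'rV[R]_d => a 0 i - z 0 i).
    exact: Ck_onD oT (Ck_on_cst k _ oT) (CN _ (Ccoord i)).
  have Cq : Ck_on k setT q.
    exact: Ck_on_sum oT (fun i => Ck_onM oT (CB i) (CB i)).
  have Cu : Ck_on k setT u.
    by apply: Ck_on_flat_fun => //; exact: Ck_onD oT (Ck_on_cst k _ oT) (CN _ Cq).
  apply: Ck_onD (Ck_on_cst k _ oT) (CN _ _) => //.
  exact: Ck_onM oT (Ck_on_cst k _ oT) Cu.
pose h z := 1 + (- (flat_fun 1 1)^-1) * flat_fun 1 (l z).
exists h; split.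
- move=> k; have oT : open [set: 'rV[R]_d] := openT.
  apply: Ck_onD (Ck_on_cst k _ oT) _ => //.
  apply: Ck_onM (Ck_on_cst k _ oT) _ => //.
  exact: Ck_on_flat_fun.
- exists (l @^-1` [set t | t < 0]); split.
  + apply: open_comp; last exact: open_lt.
    by move=> z _; have /Ck_on0P := Cl 0%N; apply => //; exact: openT.
  + by rewrite /= /l /u qa subr0 -/c divfK ?gt_eqF//; lra.
  + by move=> z /= lz; rewrite /h (flat_le0 1 (l z)) ?ltW// mulr0 addr0.
- move=> z hz; rewrite [leLHS]mx_normrE.
  have qz : q z < e ^+ 2.
    rewrite ltNge; apply: contra hz => qz.
    rewrite /h /l /u (flat_le0 1 (_ - q z)) ?subr_le0// mulr0 subr0.
    by rewrite mulNr mulVf ?subrr// gt_eqF// flat_gt0.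
  apply: bigmax_le => [|[i j] _]; first exact: ltW.
  rewrite ord1 /= !mxE -ler_sqr ?nnegrE ?(ltW e0)// -normrX ger0_norm ?sqr_ge0//.
  apply: le_trans (ltW qz); rewrite /q (bigD1 j)//= -expr2 lerDl.
  by apply: sumr_ge0 => k _; rewrite -expr2 sqr_ge0.
Qed.

Section Manifold_bump.
Context {R : realType} {d : nat} {X : smooth_manifold R d}.

(** The bump is built in a chart and extended by 0. The set [K] corresponding to a small closed ball
    is compact, hence closed because [X] is Hausdorff, so the extension vanishes on an open set that
    contains the complement of [U]. *)
Lemma smooth_bump (p : X) (U : set X) : open U -> U p ->
  exists f : X -> R, [/\ smooth_fun f,
    exists V, [/\ open V, V p & forall x, V x -> f x = 1] &
    exists W, [/\ open W, ~` U `<=` W & forall x, W x -> f x = 0]].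
Proof.
move=> oU Up; have [c Ac cp] := atlas_cover p.
pose a := chart_map c p; pose A := chart_map c @` (chart_dom c `&` U).
have oA : open A := chart_image_open oU.
have Aa : A a by exists p.
have [e eA] := (nbhs_closedballP _ _).1 (open_nbhs_nbhs (conj oA Aa)).
rewrite closed_ballE// in eA.
have [h [sh [V [oV Va hV]] he]] := bump_rV a [gt0 of e%:num].
pose K := chart_inv c @` closed_ball_ Num.norm a e%:num.
have clK : closed K.
  apply: compact_closed; first exact: manifold_hausdorff.
  apply: continuous_compact.
    apply: continuous_subspaceW (@chart_inv_cont _ _ _ c).
    by move=> z /eA[y [cy _] <-]; exists y.
  apply: bounded_closed_compact; last exact: closed_closed_ball_.
  exists (`|a| + e%:num); split; first exact: num_real.
  move=> M aM z /=; rewrite /closed_ball_ /= => az; apply: le_trans (ltW aM).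
  by rewrite -[z](subKr a) (le_trans (ler_normB _ _))// lerD2l.
have KU x : K x -> chart_dom c x /\ U x.
  by move=> [z /eA[y [cy Uy] <-] <-]; rewrite chart_mapK.
pose f x := if `[< chart_dom c x >] then h (chart_map c x) else 0.
have fc x : chart_dom c x -> f x = h (chart_map c x).
  by move=> cx; rewrite /f asboolT.
have fK x : ~ K x -> f x = 0.
  rewrite /f; case: asboolP => // cx nKx; apply: contra_notP nKx => /eqP /he hx.
  by exists (chart_map c x) => //; exact: chart_mapK.
have oc := @chart_dom_open _ _ _ c.
exists f; split.
- apply: smooth_on_local; first exact: openT.
  move=> x _; have [Kx|nKx] := pselect (K x).
    exists (chart_dom c), (h \o chart_map c).
    have [cx _] := KU x Kx; split => //; first exact: (smooth_on_chart_comp Ac oc openT).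
  exists (~` K), (fun=> 0); split => //; first exact: closed_openC.
  exact/smooth_on_cst/closed_openC.
- exists (chart_dom c `&` (chart_map c @^-1` V)); split => //.
  + rewrite openE => x [cx Vx]; apply: filterI; first exact: open_nbhs_nbhs.
    have := @chart_map_cont _ _ _ c.
    rewrite continuous_open_subspace// => /(_ _ (mem_set cx)); apply.
    exact: open_nbhs_nbhs.
  + by move=> x [cx Vx]; rewrite fc// hV.
- exists (~` K); split => //; first exact: closed_openC.
  by apply: subsetC => x /KU[].
Qed.
End Manifold_bump.

(** Each [p] has a bump equal to 1 on a basic open set [b p] around it, so the countably many basic
    sets can index the bumps: the point chosen for the code of [b x] has the same basic set as [x],
    and its bump is 1 near [x]. *)
Lemma countable_smooth_bumps (R : realType) (d : nat) (X : smooth_manifold R d)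
    (U : X -> set X) (p0 : X) :
  (forall p, open (U p)) -> (forall p, U p p) ->
  exists (q : nat -> X) (f : nat -> X -> R), [/\ forall i, smooth_fun (f i),
    forall i, exists W, [/\ open W, ~` U (q i) `<=` W &
      forall x, W x -> f i x = 0] &
    forall x, exists i V, [/\ open V, V x & forall y, V y -> f i y = 1]].
Proof.
move=> oU Up; have bump p := cid (smooth_bump (oU p) (Up p)).
pose F p := projT1 (bump p).
have [B /countable_injP[code codeI] [oB nB]] := manifold_second_countable X.
have sub p : exists b, [/\ B b, b p & forall y, b y -> F p y = 1].
  have [_ [V [oV Vp FV]] _] := projT2 (bump p).
  have [b [Bb bp] bV] := nB p V (open_nbhs_nbhs (conj oV Vp)).
  by exists b; split => // y /bV; exact: FV.
pose b p := projT1 (cid (sub p)).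
have bP p : [/\ B (b p), b p p & forall y, b p y -> F p y = 1] := projT2 (cid (sub p)).
(* Where no point has code [n] the value is [p0], which has a bump like any other point. *)
pose q n := xget p0 [set p | code (b p) = n].
exists q, (F \o q); split=> [i|i|x].
- by have [] := projT2 (bump (q i)).
- by have [] := projT2 (bump (q i)).
- exists (code (b x)), (b x).
  have qx : code (b (q (code (b x)))) = code (b x).
    by apply: (@xgetPex _ p0 [set p | code (b p) = _]); exists x.
  have [Bx bx _] := bP x; have [Bq _ Fq] := bP (q (code (b x))).
  have bq : b (q (code (b x))) = b x by apply: codeI; rewrite ?inE.
  split => //; first exact: oB.
  by move=> y bxy; apply: Fq; rewrite bq.
Qed.

(** * Matrices with smooth entries *)

Section Smooth_matrices.
Context {R : realType} {d : nat} {X : smooth_manifold R d}.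
Implicit Types U : set X.

Lemma smooth_on_mulmx m n p U (A : X -> 'M[R]_(m, n)) (B : X -> 'M[R]_(n, p)) :
  open U -> (forall i j, smooth_on U (fun x => A x i j)) ->
  (forall i j, smooth_on U (fun x => B x i j)) ->
  forall i j, smooth_on U (fun x => (A x *m B x) i j).
Proof.
move=> oU sA sB i j.
have := smooth_on_sum (index_enum 'I_n) oU
  (fun k => smooth_onM oU (sA i k) (sB k j)).
by apply: smooth_on_eq => // x _; rewrite mxE.
Qed.

Lemma smooth_on_det n U (A : X -> 'M[R]_n) :
  open U -> (forall i j, smooth_on U (fun x => A x i j)) ->
  smooth_on U (fun x => \det (A x)).
Proof.
move=> oU sA; apply: smooth_on_sum => // s.
apply: smooth_onM => //; first exact: smooth_on_cst.
exact: smooth_on_prod.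
Qed.

(** Cramer's rule: the entries are cofactors divided by the determinant, which has no zero on
    [U]. *)
Lemma smooth_on_invmx n U (A : X -> 'M[R]_n) :
  open U -> (forall x, U x -> A x \in unitmx) ->
  (forall i j, smooth_on U (fun x => A x i j)) ->
  forall i j, smooth_on U (fun x => invmx (A x) i j).
Proof.
move=> oU uA sA i j.
have sdet := smooth_on_det oU sA.
have sadj : smooth_on U (fun x => cofactor (A x) j i).
  apply: smooth_onM => //; first exact: smooth_on_cst.
  apply: smooth_on_det => // k l.
  by apply: smooth_on_eq (sA (lift j k) (lift i l)) => // x _; rewrite !mxE.
have det0 x : U x -> \det (A x) != 0.
  by move=> /uA; rewrite unitmxE unitfE.
apply: smooth_on_eq (smooth_onM oU (smooth_on_inv oU det0 sdet) sadj) => // x Ux.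
by rewrite /invmx uA// !mxE.
Qed.

End Smooth_matrices.

(** * Smooth sections *)

Section Smooth_sections.
Context {R : realType} {d : nat} {X : smooth_manifold R d} {r : nat}.
Variable E : vector_bundle X r.
Implicit Types (U V : set X) (s : forall x, E x) (t : trivialization E r).

Lemma triv_inv_linear t x : triv_dom t x -> linear (triv_inv t x).
Proof.
move=> dx a v w; apply: (can_inj (triv_mapK dx)).
by rewrite linearP !(triv_invK dx).
Qed.

Lemma triv_inv_sum_delta t x (v : 'rV[R]_r) : triv_dom t x ->
  triv_inv t x v = \sum_j v 0 j *: triv_inv t x (delta_mx 0 j).
Proof.
move=> dx; apply: (can_inj (triv_mapK dx)).
rewrite linear_sum (triv_invK dx) [LHS]row_sum_delta.
by apply: eq_bigr => j _; rewrite linearZ /= (triv_invK dx).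
Qed.

(** Sections are total families of vectors, but local ones, such as the frame of a trivialization,
    are meaningful on its domain only; hence the set [U]. *)
Definition smooth_sec_on U s := forall t, triv_atlas t ->
  smooth_on (triv_dom t `&` U) (fun x => triv_map t x (s x)).

Lemma atlas_smooth_triv t : triv_atlas t -> smooth_triv t.
Proof. by move=> At t' At'; split; exact: triv_atlas_compat. Qed.

(** [triv_compat] speaks of constant vectors; [w] is expanded in the standard basis, with smooth
    coefficients. *)
Lemma smooth_on_triv_compat t1 t2 U (w : X -> 'rV[R]_r) : triv_compat t1 t2 ->
  open U -> U `<=` triv_dom t1 `&` triv_dom t2 -> smooth_on U w ->
  smooth_on U (fun x => triv_map t2 x (triv_inv t1 x (w x))).
Proof.
move=> t12 oU Ut sw; apply/smooth_on_rowP => // k.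
have od : open (triv_dom t1 `&` triv_dom t2).
  by apply: openI; exact: triv_dom_open.
have sd j : smooth_on U (fun x => triv_map t2 x (triv_inv t1 x (delta_mx 0 j)) 0 k).
  by have /(smooth_onS oU od Ut)/smooth_on_rowP := t12 (delta_mx 0 j); exact.
have sj j := smooth_onM oU ((smooth_on_rowP w oU).1 sw j) (sd j).
apply: smooth_on_eq (smooth_on_sum (index_enum 'I_r) oU sj) => // x /Ut[dx _].
rewrite (triv_inv_sum_delta _ dx) linear_sum summxE.
by apply: eq_bigr => j _; rewrite linearZ !mxE.
Qed.

(** Trivializations adapted to a subbundle need not belong to the atlas. Near each point, the
    coordinates in [t] arise from those in an atlas trivialization by a smooth transition. *)
Lemma smooth_sec_triv t U s : smooth_triv t -> open U -> smooth_sec_on U s ->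
  smooth_on (triv_dom t `&` U) (fun x => triv_map t x (s x)).
Proof.
move=> st oU ss; have ot := @triv_dom_open _ _ _ _ t.
apply: smooth_on_local; first exact: openI.
move=> p [tp Up]; have [t' At' t'p] := triv_cover E p.
have ot' := @triv_dom_open _ _ _ _ t'; have [_ t't] := st t' At'.
exists (triv_dom t' `&` triv_dom t `&` U).
exists (fun x => triv_map t x (triv_inv t' x (triv_map t' x (s x)))).
have o3 : open (triv_dom t' `&` triv_dom t `&` U) by do 2 apply: openI => //.
split => //; last by move=> x [[t'x _] _]; rewrite triv_mapK.
apply: smooth_on_triv_compat => //.
  apply: smooth_onS (ss t' At') => //; first exact: openI.
  by move=> x [[? _] ?].
Qed.

Lemma triv_smooth_sec t U s : smooth_triv t -> open U -> U `<=` triv_dom t ->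
  smooth_on U (fun x => triv_map t x (s x)) -> smooth_sec_on U s.
Proof.
move=> st oU Ut ss t' At'; have [tt' _] := st t' At'.
have ot' := @triv_dom_open _ _ _ _ t'.
have oU' : open (triv_dom t' `&` U) by exact: openI.
apply: (smooth_on_eq
  (g := fun x => triv_map t' x (triv_inv t x (triv_map t x (s x))))) => //.
  by move=> x [_ /Ut tx]; rewrite triv_mapK.
apply: smooth_on_triv_compat => //; first by move=> x [t'x /Ut].
by apply: smooth_onS ss => // x [].
Qed.

Lemma smooth_sec_on_local U s : open U ->
  (forall x, U x -> exists V s', [/\ open V, V x, smooth_sec_on V s' &
    forall y, V y -> s y = s' y]) -> smooth_sec_on U s.
Proof.
move=> oU loc t At; have ot := @triv_dom_open _ _ _ _ t.
apply: smooth_on_local; first exact: openI.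
move=> x [tx /loc[V [s' [oV Vx ss' ss]]]].
exists (triv_dom t `&` V), (fun x => triv_map t x (s' x)); split => //.
- exact: openI.
- exact: ss'.
- by move=> y [_ /ss ->].
Qed.

Lemma smooth_sec_onS U V s : open U -> open V -> U `<=` V ->
  smooth_sec_on V s -> smooth_sec_on U s.
Proof.
by move=> oU oV UV sV; apply: smooth_sec_on_local => // x /UV Vx; exists V, s.
Qed.

Lemma smooth_sec_on0 U : open U -> smooth_sec_on U (fun x => 0).
Proof.
move=> oU t At; have ot := @triv_dom_open _ _ _ _ t.
have oU' : open (triv_dom t `&` U) by exact: openI.
by apply: smooth_on_eq (smooth_on_cst 0 oU') => // x _; rewrite linear0.
Qed.

Lemma smooth_sec_onP U (f : X -> R) s s' : open U -> smooth_on U f ->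
  smooth_sec_on U s -> smooth_sec_on U s' ->
  smooth_sec_on U (fun x => f x *: s x + s' x).
Proof.
move=> oU sf ss ss' t At; have ot := @triv_dom_open _ _ _ _ t.
have oU' : open (triv_dom t `&` U) by exact: openI.
have sf' : smooth_on (triv_dom t `&` U) f by apply: smooth_onS sf => // x [].
apply/smooth_on_rowP => // j.
have sj := (smooth_on_rowP _ oU').1 (ss t At) j.
have sj' := (smooth_on_rowP _ oU').1 (ss' t At) j.
apply: smooth_on_eq (smooth_onD oU' (smooth_onM oU' sf' sj) sj') => // x _.
by rewrite linearP !mxE.
Qed.

Lemma smooth_sec_triv_inv t U (w : X -> 'rV[R]_r) : smooth_triv t -> open U ->
  U `<=` triv_dom t -> smooth_on U w ->
  smooth_sec_on U (fun x => triv_inv t x (w x)).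
Proof.
move=> st oU Ut sw; apply: (triv_smooth_sec st) => //.
by apply: smooth_on_eq sw => // x /Ut tx; rewrite triv_invK.
Qed.

Lemma pairing_sum_delta (C : courant_algebroid E) t x (u v : E x) :
  triv_dom t x ->
  pairing C x u v = \sum_i \sum_j triv_map t x u 0 i * (triv_map t x v 0 j *
    pairing C x (triv_inv t x (delta_mx 0 i)) (triv_inv t x (delta_mx 0 j))).
Proof.
move=> tx.
rewrite -{1}(triv_mapK tx u) -{1}(triv_mapK tx v) !(triv_inv_sum_delta _ tx).
rewrite linear_sumlz; apply: eq_bigr => i _; rewrite linearZl_LR linear_sumr mulr_sumr.
by apply: eq_bigr => j _; rewrite linearZr_LR.
Qed.

Lemma smooth_pairing (C : courant_algebroid E) U s1 s2 : open U ->
  smooth_sec_on U s1 -> smooth_sec_on U s2 ->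
  smooth_on U (fun x => pairing C x (s1 x) (s2 x) : R).
Proof.
move=> oU ss1 ss2; apply: smooth_on_local => // p Up.
have [t At tp] := triv_cover E p; have ot := @triv_dom_open _ _ _ _ t.
have oU' : open (triv_dom t `&` U) by exact: openI.
exists (triv_dom t `&` U), (fun x => pairing C x (s1 x) (s2 x) : R); split => //.
have sg i j : smooth_on (triv_dom t `&` U) (fun x =>
    pairing C x (triv_inv t x (delta_mx 0 i)) (triv_inv t x (delta_mx 0 j)) : R).
  by apply: smooth_onS (pairing_smooth C At _ _) => // x [].
have sij i j := smooth_onM oU' ((smooth_on_rowP _ oU').1 (ss1 t At) i)
  (smooth_onM oU' ((smooth_on_rowP _ oU').1 (ss2 t At) j) (sg i j)).
have si i := smooth_on_sum (index_enum 'I_r) oU' (sij i).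
apply: smooth_on_eq (smooth_on_sum (index_enum 'I_r) oU' si) => // x [tx _].
exact: pairing_sum_delta.
Qed.

End Smooth_sections.

(** * Lagrangian projections *)

Section Lagrangian_projections.
Context {R : realType} {d : nat} {X : smooth_manifold R d} {r : nat}.
Context {E : vector_bundle X r}.
Variable C : courant_algebroid E.
Implicit Types (U V : set X) (t : trivialization E r).

(* For c = 1 these conditions say that p is the projection onto L along a
   lagrangian complement. They are affine in (c, p), so that the p can be glued
   by a partition of unity. *)
Definition lag_proj (x : X) (L : set (E x)) (c : R) (p : E x -> E x) : Prop :=
  [/\ linear p, forall u, L (p u), forall u, L u -> p u = c *: u &
      forall u v, pairing C x (p u) v + pairing C x u (p v) = c * pairing C x u v].

(** Here [q] is the adjoint of [p]. For v in [L], the pairing of u + p u - q u with v is <u, v> + 0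
    - <u, p v> = 0, so the values lie in L^perp = [L]. The skew part [p - q] cancels in the pairing
    identity. *)
Lemma lag_proj_of_adjoint x (L : set (E x)) (p q : E x -> E x) :
  L = orthogonal_of C L -> linear p -> linear q ->
  (forall u, L (p u)) -> (forall u, L u -> p u = u) ->
  (forall u v, pairing C x (q u) v = pairing C x u (p v)) ->
  lag_proj L 1 (fun u => 2^-1 *: (u + p u - q u)).
Proof.
move=> LE lp lq Lp pL qp.
have LL u v : L u -> L v -> pairing C x u v = 0 by rewrite {1}LE => + Lv; exact.
have pE u v w z : pairing C x (2^-1 *: (u + v - w)) z =
    2^-1 * (pairing C x u z + pairing C x v z - pairing C x w z).
  by rewrite linearZl_LR linearBl linearDl.
have h2 : 2^-1 + 2^-1 = 1 :> R by lra.
split.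
- move=> a u v; rewrite lp lq.
  have -> : a *: u + v + (a *: p u + p v) - (a *: q u + q v) =
      a *: (u + p u - q u) + (v + p v - q v).
    by rewrite scalerBr scalerDr opprD [X in X + _]addrACA [LHS]addrACA.
  by rewrite scalerDr !scalerA mulrC.
- move=> u; rewrite LE => v Lv; rewrite pE qp (pL v)//.
  by rewrite (LL (p u) v)// addr0 subrr mulr0.
- move=> u Lu; have -> : q u = 0.
    by apply: (pairing_nondeg (c := C)) => v; rewrite qp LL.
  by rewrite pL// subr0 scalerDr -scalerDl h2.
- move=> u v; rewrite pE [X in _ + X](pairing_sym C u) pE !qp.
  rewrite (pairing_sym C v u) (pairing_sym C v (p u)) (pairing_sym C (p v) u).
  by rewrite -mulrDr; lra.
Qed.

(** Testing on sections over all open subsets of [U] lets the property restrict to smaller sets, as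
    the gluing requires. *)
Definition smooth_endo_on U (p : forall x, E x -> E x) := forall V s,
  open V -> V `<=` U -> smooth_sec_on V s -> smooth_sec_on V (fun x => p x (s x)).

Definition gram t x : 'M[R]_r := \matrix_(i, j)
  pairing C x (triv_inv t x (delta_mx 0 i)) (triv_inv t x (delta_mx 0 j)).

Lemma pairing_gram t x (u v : E x) : triv_dom t x ->
  pairing C x u v = (triv_map t x u *m gram t x *m (triv_map t x v)^T) 0 0.
Proof.
move=> tx; rewrite (pairing_sum_delta C _ _ tx) -mulmxA mxE.
apply: eq_bigr => i _; rewrite -mulr_sumr; congr (_ * _); rewrite mxE.
by apply: eq_bigr => j _; rewrite !mxE mulrC.
Qed.

(** A row killed by the Gram matrix represents a vector orthogonal to the whole fibre. *)
Lemma gram_unitmx t x : triv_dom t x -> gram t x \in unitmx.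
Proof.
move=> tx; rewrite -row_free_unit -kermx_eq0; apply/rowV0P => w /sub_kermxP wG.
rewrite -(triv_invK tx w); suff -> : triv_inv t x w = 0 by rewrite linear0.
apply: (pairing_nondeg (c := C)) => v.
by rewrite (pairing_gram _ _ tx) triv_invK// wG mul0mx mxE.
Qed.

Lemma smooth_gram t : smooth_triv t -> forall i j,
  smooth_on (triv_dom t) (fun x => gram t x i j).
Proof.
move=> st i j; have ot := @triv_dom_open _ _ _ _ t.
have sd k : smooth_sec_on (triv_dom t) (fun x => triv_inv t x (delta_mx 0 k)).
  by apply: smooth_sec_triv_inv => //; exact: smooth_on_cst.
by apply: smooth_on_eq (smooth_pairing C ot (sd i) (sd j)) => // x _; rewrite mxE.
Qed.

Lemma smooth_endo_triv t (A : X -> 'M[R]_r) : smooth_triv t ->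
  (forall i j, smooth_on (triv_dom t) (fun x => A x i j)) ->
  smooth_endo_on (triv_dom t)
    (fun x u => triv_inv t x (triv_map t x u *m A x)).
Proof.
move=> st sA V s oV Vt ss; have ot := @triv_dom_open _ _ _ _ t.
apply: smooth_sec_triv_inv => //; apply/smooth_on_rowP => // j.
apply: (smooth_on_mulmx (A := fun x => triv_map t x (s x))) => // [i k|i k].
  have := smooth_sec_triv st oV ss; rewrite (setIidr Vt) => /smooth_on_rowP.
  by rewrite (ord1 i); apply.
exact: smooth_onS (sA i k).
Qed.

Lemma local_lag_proj (L : forall x, set (E x)) k :
  (forall x, L x = orthogonal_of C (L x)) -> subbundle k L ->
  forall p : X, exists U (q : forall x, E x -> E x), [/\ open U, U p,
    smooth_endo_on U q & forall x, U x -> lag_proj (L x) 1 (q x)].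
Proof.
move=> LE [kr Lt] p; have [t [st tp Lk]] := Lt p.
have ot := @triv_dom_open _ _ _ _ t.
(* In the adapted trivialization [D] projects onto [L], and [A] is its adjoint: with G the Gram
   matrix, u A G v^T = u G (v D)^T. *)
pose D : 'M[R]_r := pid_mx k.
pose A x : 'M[R]_r := gram t x *m D^T *m invmx (gram t x).
pose B x := 2^-1 *: (1%:M + D - A x).
have vD (v : 'rV[R]_r) j : (v *m D) 0 j = if (j < k)%N then v 0 j else 0.
  rewrite mxE (bigD1 j)//= big1 ?addr0 => [|i ij]; rewrite !mxE.
    by rewrite eqxx /=; case: ifP; rewrite ?mulr1 ?mulr0.
  by rewrite (inj_eq val_inj) (negPf ij) mulr0.
exists (triv_dom t), (fun x u => triv_inv t x (triv_map t x u *m B x)).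
split => //.
  apply: smooth_endo_triv => // i j.
  have sc a : smooth_on (triv_dom t) (fun=> a : R) by exact: smooth_on_cst.
  have sA : smooth_on (triv_dom t) (fun x => A x i j).
    apply: (smooth_on_mulmx (A := fun x => gram t x *m D^T)) => // i' j'.
      apply: (smooth_on_mulmx (A := gram t) (B := fun=> D^T)) => // ? ?.
      exact: smooth_gram.
    apply: smooth_on_invmx => //; first exact: gram_unitmx.
    exact: smooth_gram.
  apply: smooth_on_eq (smooth_onM ot (sc 2^-1) (smooth_onD ot
    (sc ((1%:M + D) i j)) (smooth_onM ot (sc (-1)) sA))) => // x _.
  by rewrite mulN1r !mxE.
move=> x tx.
pose P (u : E x) := triv_inv t x (triv_map t x u *m D).
pose Q (u : E x) := triv_inv t x (triv_map t x u *m A x).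
have lM (M : 'M[R]_r) : linear (fun u : E x => triv_inv t x (triv_map t x u *m M)).
  move=> a u v; rewrite linearP mulmxDl -scalemxAl.
  exact: (triv_inv_linear tx).
have -> : (fun u : E x => triv_inv t x (triv_map t x u *m B x)) =
    (fun u => 2^-1 *: (u + P u - Q u)).
  apply/funext => u; apply: (can_inj (triv_mapK tx)).
  rewrite (triv_invK tx) /B -scalemxAr mulmxBr mulmxDr mulmx1.
  rewrite [RHS]linearZ; congr (_ *: _).
  by rewrite linearB linearD /P /Q !(triv_invK tx).
apply: (lag_proj_of_adjoint (LE x)); rewrite ?Lk//; try exact: lM.
- by move=> u i ki; rewrite (triv_invK tx) vD ltnNge ki.
- move=> u Lu; rewrite /P; rewrite (_ : _ *m D = triv_map t x u) ?triv_mapK//.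
  by apply/rowP => j; rewrite vD; case: ltnP => // /Lu ->.
- move=> u v; rewrite !(pairing_gram _ _ tx) !(triv_invK tx).
  by rewrite trmx_mul !mulmxA mulmxKV ?gram_unitmx.
Qed.
End Lagrangian_projections.

(** * Gluing local projections by a partition of unity *)

Section Gluing.
Context {R : realType} {d : nat} {X : smooth_manifold R d} {r : nat}.
Context {E : vector_bundle X r}.
Variable C : courant_algebroid E.

Lemma lag_proj0 x (L : set (E x)) : L = orthogonal_of C L ->
  lag_proj C L 0 (fun=> 0).
Proof.
move=> LE; split=> [a u v|u|u _|u v].
- by rewrite scaler0 addr0.
- by rewrite LE => v _; rewrite linear0l.
- by rewrite scale0r.
- by rewrite linear0l linear0r addr0 mul0r.
Qed.

Lemma lag_projP x (L : set (E x)) (c a b : R) (p q : E x -> E x) :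
  L = orthogonal_of C L -> lag_proj C L a p -> lag_proj C L b q ->
  lag_proj C L (c * a + b) (fun u => c *: p u + q u).
Proof.
move=> LE [lp Lp pL pp] [lq Lq qL qq]; split.
- move=> e u v; rewrite lp lq !scalerDr !scalerA [c * e]mulrC.
  exact: addrACA.
- have := Lp; have := Lq; rewrite {1 2}LE => Lq' Lp' u; rewrite LE => v Lv.
  by rewrite linearPl Lp'// Lq'// addr0 mulr0.
- by move=> u Lu; rewrite pL// qL// scalerDl scalerA.
- move=> u v; rewrite linearPl linearPr addrACA -mulrDr pp qq.
  by rewrite mulrDl mulrA.
Qed.

Variables (f : nat -> X -> R) (p : nat -> forall x, E x -> E x).

Fixpoint rest N x : R := if N is N'.+1 then rest N' x * (1 - f N' x) else 1.

(* The weights rest i * f i telescope: their sum over i < N is 1 - rest N. Where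
   some f i is 1 all later weights vanish, so that near a point at which f i is
   locally 1 the sequence is stationary. *)
Fixpoint glue N x (u : E x) : E x :=
  if N is N'.+1 then (rest N' x * f N' x) *: p N' u + glue N' u else 0.

Lemma rest_eq0 i N x : f i x = 1 -> (i < N)%N -> rest N x = 0.
Proof.
move=> fi; elim: N => // N IH; rewrite ltnS leq_eqVlt => /predU1P[<-|iN] /=.
  by rewrite fi subrr mulr0.
by rewrite IH// mul0r.
Qed.

Lemma glue_stationary i N x (u : E x) : f i x = 1 -> (i < N)%N ->
  glue N u = glue i.+1 u.
Proof.
move=> fi; elim: N => // N IH; rewrite ltnS leq_eqVlt => /predU1P[<-//|iN].
by rewrite -IH//= (rest_eq0 fi iN) mul0r scale0r add0r.
Qed.

(** Where [f N] vanishes the new term is 0, so [p N] may be arbitrary there. Elsewhere the total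
    weights add up: rest N f N + (1 - rest N) = 1 - rest N (1 - f N). *)
Lemma lag_proj_glue N x (L : set (E x)) : L = orthogonal_of C L ->
  (forall i, f i x != 0 -> lag_proj C L 1 (@p i x)) ->
  lag_proj C L (1 - rest N x) (@glue N x).
Proof.
move=> LE Lp; elim: N => [|N IH] /=; first by rewrite subrr; exact: lag_proj0.
have [f0|f0] := eqVneq (f N x) 0.
  rewrite (_ : (fun _ => _) = @glue N x); last first.
    by apply/funext => u; rewrite f0 mulr0 scale0r add0r.
  by rewrite f0 subr0 mulr1.
have := lag_projP (rest N x * f N x) LE (Lp N f0) IH.
by congr (lag_proj _ _ _ _); ring.
Qed.

(** [p N] is smooth over [U N] only, but this set and the open set [W] where [f N] vanishes cover
    [X]; on [W] the new term is 0. *)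
Lemma smooth_glue (U : nat -> set X) N : (forall i, smooth_fun (f i)) ->
  (forall i, open (U i)) -> (forall i, smooth_endo_on (U i) (@p i)) ->
  (forall i, exists W, [/\ open W, ~` U i `<=` W & forall x, W x -> f i x = 0]) ->
  smooth_endo_on setT (@glue N).
Proof.
move=> sf oU sp fW V s oV _ ss.
have sfV i : smooth_on V (f i) by apply: smooth_onS (sf i) => //; exact: openT.
have sc a : smooth_on V (fun=> a : R) by exact: smooth_on_cst.
have srest M : smooth_on V (rest M).
  elim: M => [|M IH] //=; apply: smooth_onM => //.
  apply: smooth_on_eq (smooth_onD oV (sc 1) (smooth_onM oV (sc (-1)) (sfV M))) => //.
  by move=> x _; rewrite mulN1r.
elim: N => [|N IH] /=; first exact: smooth_sec_on0.
apply: smooth_sec_on_local => // x Vx; have [W [oW UW fW0]] := fW N.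
have [Ux|nUx] := pselect (U N x).
  have oVU : open (V `&` U N) by exact: openI.
  exists (V `&` U N), (fun x => (rest N x * f N x) *: p N (s x) + glue N (s x)).
  split => //; apply: smooth_sec_onP => //.
  - by apply: smooth_onS (smooth_onM oV (srest N) (sfV N)) => // y [].
  - apply: sp => //.
    by apply: smooth_sec_onS ss => // y [].
  - by apply: smooth_sec_onS IH => // y [].
have oVW : open (V `&` W) by exact: openI.
exists (V `&` W), (fun x => glue N (s x)); split => //.
- by split => //; exact: UW.
- by apply: smooth_sec_onS IH => // y [].
- by move=> y [_ Wy]; rewrite fW0// mulr0 scale0r add0r.
Qed.

End Gluing.

(** The glued sum is taken up to a stage [(N x).+1] chosen separately at each point. It is still
    smooth: where some [f i] is 1 on an open set, it agrees there with the sum up to the fixed stage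
    [i.+1]. *)
Lemma global_lag_proj (R : realType) (d : nat) (X : smooth_manifold R d) (r : nat)
    (E : vector_bundle X r) (C : courant_algebroid E) (L : forall x, set (E x)) k
    (p0 : X) :
  (forall x, L x = orthogonal_of C (L x)) -> subbundle k L ->
  exists q : forall x, E x -> E x,
    smooth_endo_on setT q /\ forall x, lag_proj C (L x) 1 (q x).
Proof.
move=> LE sL; have loc p := cid (local_lag_proj LE sL p).
pose U p := projT1 (loc p); pose loc' p := cid (projT2 (loc p)).
pose e p := projT1 (loc' p).
have UP p : [/\ open (U p), U p p, smooth_endo_on (U p) (e p) &
    forall x, U p x -> lag_proj C (L x) 1 (e p x)] := projT2 (loc' p).
have [||qs [f [sf fW f1]]] := @countable_smooth_bumps _ _ X U p0.
- by move=> p; have [] := UP p.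
- by move=> p; have [] := UP p.
pose N x := projT1 (cid (f1 x)).
have fN x : f (N x) x = 1.
  by have [V [oV Vx fV]] := projT2 (cid (f1 x)); exact: fV.
pose G M x := @glue _ _ _ _ E f (fun i => e (qs i)) M x.
have sG M : smooth_endo_on setT (G M).
  apply: (smooth_glue (U := U \o qs)) => // i; have [] := UP (qs i) => //.
have GE i j x : f i x = 1 -> f j x = 1 -> G i.+1 x = G j.+1 x.
  move=> fi fj; apply/funext => u; wlog ij : i j fi fj / (i <= j)%N.
    by move=> W; case: (leqP i j) => [|/ltnW] ij; [exact: W|exact/esym/W].
  by apply/esym; exact: (glue_stationary _ _ fi).
exists (fun x => G (N x).+1 x); split=> [V s oV _ ss|x].
  apply: smooth_sec_on_local => // x Vx.
  have [i [W [oW Wx fW1]]] := f1 x.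
  exists (V `&` W), (fun x => G i.+1 x (s x)); split => //.
  - exact: openI.
  - apply: sG => //; first exact: openI.
    by apply: (smooth_sec_onS _ oV _ ss) => [|y []//]; exact: openI.
  - by move=> y [_ Wy]; rewrite (@GE (N y) i)// fW1.
(* As [f (N x)] is 1 at [x], no weight is left over after this stage. *)
have -> : 1 = 1 - rest f (N x).+1 x by rewrite (@rest_eq0 _ _ _ _ (N x)) ?subr0.
apply: lag_proj_glue => // i fi0; have [_ _ _ Lq] := UP (qs i); apply: Lq.
have [W [_ UW fW0]] := fW i.
by apply: contrapT => /UW/fW0/eqP; rewrite (negPf fi0).
Qed.

(** * The kernel of a lagrangian projection *)

Section Kernel_of_lagrangian_projection.
Context {R : realType} {d : nat} {X : smooth_manifold R d} {r : nat}.
Context {E : vector_bundle X r}.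
Variable C : courant_algebroid E.

(** The pairing identity makes the kernel isotropic. Conversely, if u is orthogonal to the kernel,
    which contains every v - q v, then <u, v> = <u, q v>, so the identity leaves <q u, v> = 0 for
    all v. *)
Lemma lag_proj_ker_lagrangian x (L : set (E x)) (q : E x -> E x) :
  L = orthogonal_of C L -> lag_proj C L 1 q ->
  [set u | q u = 0] = orthogonal_of C [set u | q u = 0].
Proof.
move=> LE [lq Lq qL qq]; apply/seteqP; split=> u /= qu.
  move=> v /= qv; have := qq u v.
  by rewrite qu qv linear0l linear0r addr0 mul1r.
apply: (pairing_nondeg (c := C)) => v.
have qqv : q (v - q v) = 0.
  have := lq (-1) (q v) v.
  by rewrite (qL (q v))// !scaleN1r scale1r addNr addrC.
have := qq u v; rewrite mul1r => quv; have := qu _ qqv.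
by rewrite linearBr -quv addrK.
Qed.

Lemma lag_proj_ker_complement x (L : set (E x)) (q : E x -> E x) :
  L = orthogonal_of C L -> lag_proj C L 1 q ->
  L `&` [set u | q u = 0] = [set 0] /\
  forall u, exists l m, [/\ L l, q m = 0 & u = l + m].
Proof.
move=> LE [lq Lq qL qq]; have q0 : q 0 = 0.
  by have := lq (-1) 0 0; rewrite scaleN1r oppr0 addr0 scaleN1r addNr.
split; last first.
  move=> u; exists (q u), (u - q u); split => //; last by rewrite addrC subrK.
  have := lq (-1) (q u) u.
  by rewrite (qL (q u))// !scaleN1r scale1r addNr addrC.
apply/seteqP; split=> u /= => [[Lu qu]|->].
  by rewrite -[u]scale1r -qL.
by split => //; rewrite -q0; exact: Lq.
Qed.

Definition rev_row (v : 'rV[R]_r) : 'rV[R]_r := \row_i v 0 (rev_ord i).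

Lemma rev_rowK : involutive rev_row.
Proof. by move=> v; apply/rowP => i; rewrite !mxE rev_ordK. Qed.

(* Reversing the coordinates turns the vanishing of the first k of them, which
   characterizes the kernel, into the vanishing of those of index at least r - k. *)
Lemma lag_proj_ker_subbundle (L : forall x, set (E x)) k
    (q : forall x, E x -> E x) :
  subbundle k L -> smooth_endo_on setT q ->
  (forall x, lag_proj C (L x) 1 (q x)) ->
  subbundle (r - k) (fun x => [set u | q x u = 0]).
Proof.
move=> [kr Lt] sq Lq; split; first exact: leq_subr.
move=> p; have [t [st tp Lk]] := Lt p.
have ot := @triv_dom_open _ _ _ _ t.
pose N : 'M[R]_r := copid_mx k.
have vN (v : 'rV[R]_r) j : (v *m N) 0 j = if (j < k)%N then 0 else v 0 j.
  rewrite mulmxBr mulmx1 !mxE (bigD1 j)//= big1 ?addr0.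
    by rewrite mxE eqxx /=; case: ifP; rewrite ?mulr1 ?subrr// mulr0 subr0.
  by move=> i ij; rewrite mxE (inj_eq val_inj) (negPf ij) mulr0.
have NN : N *m N = N by exact: copid_mx_id.
have lq x : linear (q x) by have [] := Lq x.
(* Before the reversal, the first [k] coordinates are those of [q x u], which lies in [L], and the
   others those of [u]. *)
pose map x (u : E x) := rev_row (triv_map t x (q x u) + triv_map t x u *m N).
have lmap x : linear (map x).
  move=> a u v; apply/rowP => i; rewrite /map (lq x) !linearP mulmxDl -scalemxAl.
  rewrite !mxE; ring.
pose lin x : {linear E x -> 'rV[R]_r} :=
  HB.pack (map x) (GRing.isLinear.Build _ _ _ _ (map x) (lmap x)).
(* With w = [rev_row v] and P the map [q] in coordinates, w - P(w N) agrees with w from coordinate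
   [k] on, and P sends it to P(w - w N) = w - w N, because P fixes vectors supported in the first
   [k] coordinates. *)
pose inv x (v : 'rV[R]_r) : E x :=
  triv_inv t x (rev_row v) - q x (triv_inv t x (rev_row v *m N)).
pose P x v := triv_map t x (q x (triv_inv t x v)).
have lP x : triv_dom t x -> linear (P x).
  move=> tx a u v; rewrite /P (triv_inv_linear tx) lq.
  by rewrite linearP.
have PB x u v : triv_dom t x -> P x (u - v) = P x u - P x v.
  move=> tx; have := lP x tx (-1) v u; rewrite !scaleN1r => PE.
  by rewrite [u - v]addrC PE addrC.
have PN x v : triv_dom t x -> P x v *m N = 0.
  move=> tx; apply/rowP => j; rewrite vN mxE; case: ltnP => // kj.
  have [_ + _ _] := Lq x; rewrite (Lk x tx) => Lqx.
  exact: Lqx.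
have Pid x v : triv_dom t x -> v *m N = 0 -> P x v = v.
  move=> tx v0; have [_ _ qL _] := Lq x.
  rewrite /P qL ?scale1r ?(triv_invK tx)// (Lk x tx) /= => i ki.
  by have /rowP/(_ i) := v0; rewrite vN ltnNge ki (triv_invK tx) mxE.
have tmap x u : triv_dom t x ->
    lin x u = rev_row (P x (triv_map t x u) + triv_map t x u *m N).
  by move=> tx; rewrite /lin /= /map /P (triv_mapK tx).
have tinv x v : triv_dom t x ->
    triv_map t x (inv x v) = rev_row v - P x (rev_row v *m N).
  by move=> tx; rewrite /inv linearB (triv_invK tx).
have linK x : triv_dom t x -> cancel (lin x) (inv x).
  move=> tx u; apply: (can_inj (triv_mapK tx)).
  rewrite tinv// tmap// rev_rowK; set v := triv_map t x u.
  rewrite mulmxDl PN// add0r -mulmxA NN.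
  have := Pid x (v - v *m N) tx; rewrite mulmxBl -mulmxA NN subrr => /(_ erefl).
  rewrite PB// => /eqP; rewrite subr_eq => /eqP ->.
  by rewrite addrAC addrK subrK.
have invK x : triv_dom t x -> cancel (inv x) (lin x).
  move=> tx v; rewrite tmap// tinv//; set w := rev_row v.
  rewrite mulmxBl PN// subr0 PB// (Pid _ (P x _))// ?PN//.
  rewrite -PB// Pid//; last by rewrite mulmxBl -mulmxA NN subrr.
  by rewrite subrK rev_rowK.
pose s := Trivialization (E := E) ot linK invK.
have srev U (w : X -> 'rV[R]_r) : open U -> smooth_on U w ->
    smooth_on U (fun x => rev_row (w x)).
  move=> oU /smooth_on_rowP sw; apply/smooth_on_rowP => // j.
  by apply: smooth_on_eq (sw oU (rev_ord j)) => // x _; rewrite mxE.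
exists s; split => //.
- move=> t' At'; have ot' := @triv_dom_open _ _ _ _ t'; split=> v.
    (* Towards the atlas: [inv x v] is a smooth section over [triv_dom t], being built from frame
       sections and [q]. *)
    rewrite setIC; pose w := rev_row v.
    have sinv a : smooth_sec_on (triv_dom t) (fun x => triv_inv t x a).
      by apply: smooth_sec_triv_inv => //; exact: smooth_on_cst.
    have sN : smooth_on (triv_dom t) (fun=> (-1) : R) by exact: smooth_on_cst.
    have ss := smooth_sec_onP ot sN (sq _ _ ot (@subsetT _ _) (sinv (w *m N))) (sinv w).
    have oI : open (triv_dom t' `&` triv_dom t) by exact: openI.
    apply: smooth_on_eq (smooth_sec_triv (atlas_smooth_triv At') ot ss) => // x _.
    by rewrite scaleN1r addrC.
  (* From the atlas: both summands in [map] are smooth along the sections that are constant in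
     [t']. *)
  have oI : open (triv_dom t' `&` triv_dom t) by exact: openI.
  have su : smooth_sec_on (triv_dom t' `&` triv_dom t) (fun x => triv_inv t' x v).
    apply: smooth_sec_triv_inv => //; first exact: atlas_smooth_triv.
    exact: smooth_on_cst.
  have It : triv_dom t `&` (triv_dom t' `&` triv_dom t) = triv_dom t' `&` triv_dom t.
    by rewrite setIC -setIA setIid.
  have s1 := smooth_sec_triv st oI su.
  have s2 := smooth_sec_triv st oI (sq _ _ oI (@subsetT _ _) su).
  rewrite It in s1 s2; apply: srev => //; apply: smooth_onD => //.
  apply/smooth_on_rowP => // j.
  apply: (smooth_on_mulmx (A := fun x => triv_map t x (triv_inv t' x v))
    (B := fun=> N)) => // i l; last exact: smooth_on_cst.
  by rewrite (ord1 i); exact: ((smooth_on_rowP _ oI).1 s1).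
- move=> x tx; have {}tx : triv_dom t x := tx.
  have [_ + _ _] := Lq x; rewrite (Lk x tx) /= => Lqx.
  (* An index i with r - k <= i is reversed to r - i - 1 < k, where the summand with [N]
     vanishes. *)
  have tE u (i : 'I_r) : (r - k <= i)%N ->
      lin x u 0 i = triv_map t x (q x u) 0 (rev_ord i).
    move=> ki; rewrite tmap// mxE [LHS]mxE vN ifT ?addr0 /P ?triv_mapK//=.
    by have := ltn_ord i; lia.
  apply/seteqP; split=> u /= qu.
    by move=> i ki; rewrite tE// qu linear0 mxE.
  apply: (can_inj (triv_mapK tx)); rewrite linear0; apply/rowP => j; rewrite mxE.
  (* From index [k] on, the coordinates of [q x u] vanish because it lies in [L]. *)
  have [kj|jk] := leqP k j; first exact: Lqx.
  rewrite -[j]rev_ordK -tE ?qu//=; have := ltn_ord j; lia.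
Qed.

End Kernel_of_lagrangian_projection.

(** * The complement as the kernel of a global projection *)

Theorem proposition2p19 (R : realType) (d : nat) (X : smooth_manifold R d)
    (r : nat) (E : vector_bundle X r) (C : courant_algebroid E) (n : nat)
    (hsig : pairing_has_signature C n n)
    (L : forall x : X, set (E x)) (hL : lagrangian_subbundle C L) :
  exists M : forall x : X, set (E x),
    lagrangian_subbundle C M /\ direct_sum_decomposition L M.
Proof.
have [[k sL] LE] := hL.
(* A point of [X] serves as the default in the enumeration of the bumps. Over the empty manifold the
   decomposition is vacuous and [L] itself is a complement. *)
have [[p0]|X0] := pselect (inhabited X); last first.
  by exists L; split=> // x; exfalso; apply: X0; exists.
have [q [sq Lq]] := global_lag_proj p0 LE sL.
exists (fun x => [set u | q x u = 0]); split.
  split; first by exists (r - k)%N; exact: (lag_proj_ker_subbundle sL sq Lq).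
  by move=> x; exact: lag_proj_ker_lagrangian (LE x) (Lq x).
by move=> x; exact: lag_proj_ker_complement (LE x) (Lq x).
Qed.
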